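(* A finite undirected graph $G$ (parallel edges allowed) has the uniqueness property if and only if $G$ has no cycle of length $3$ or more.
   Context: Atomic splittable network congestion games. Let $G=(V,E)$ be a finite undirected graph, possibly with parallel edges. In an atomic splittable network congestion game on $G$ there is a finite set $N$ of players; each player $i$ has a weight $d_i\ge0$, a source $s_i\in V$ and a sink $t_i\in V$ (connected in $G$), and her collection of allowable subsets $\mathcal{S}_i\subseteq 2^E$ is the set of (edge sets of) simple $s_i$-$t_i$ paths in $G$. A strategy of player $i$ is a vector in $P_i=\{\vec x_i\in\mathbb{R}_{\ge0}^{|\mathcal{S}_i|} : \sum_{S\in\mathcal{S}_i}x_S=d_i\}$. It induces loads $x_{i,e}=\sum_{S\in\mathcal{S}_i:e\in S}x_S$, and the total load on $e$ is $x_e=\sum_{i\in N}x_{i,e}$. There are player-specific cost functions $c_{i,e}:\mathbb{R}_{\ge0}\to\mathbb{R}_{\ge0}$, which are non-negative, strictly increasing, differentiable and convex. The cost of player $i$ is $\pi_i(\vec x)=\sum_{e\in E}c_{i,e}(x_e)x_{i,e}$; a Nash equilibrium is a strategy profile from which no player can reduce her cost by a unilateral deviation. Two equilibria $\vec x,\vec y$ are different if $x_{i,e}\ne y_{i,e}$ for some player $i$ and resource $e$; equilibria are unique if there are no two different equilibria. Uniqueness property. $G$ has the uniqueness property if for every atomic splittable network congestion game on $G$ (for any finite number of players, any sources and sinks in $V$, any weights and any admissible player-specific cost functions) the equilibria are unique. *)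

(* Defs.v *)
From mathcomp Require Import all_boot all_order all_algebra.
From mathcomp Require Import all_classical all_reals all_analysis.

Set Implicit Arguments.
Unset Strict Implicit.
Unset Printing Implicit Defensive.

Import Order.TTheory GRing.Theory Num.Theory.
Import numFieldNormedType.Exports.

Local Open Scope classical_set_scope.
Local Open Scope ring_scope.

(* Edges are undirected: [ends e] lists the two ends of [e] in an arbitrary
   order, which [joins] forgets. Parallel edges are distinct elements of [edge]
   with the same ends. *)
Record multigraph := Multigraph {
  vertex : finType;
  edge : finType;
  ends : edge -> vertex * vertex
}.

Section Paths.
Variable G : multigraph.
Implicit Types (u v s t : vertex G) (e : edge G).

Definition joins e u v : bool := (ends e == (u, v)) || (ends e == (v, u)).

(* The walk u, e_1, v_1, ..., e_k, v_k is given by its first vertex u and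
   the sequence p = [:: (e_1, v_1); ...; (e_k, v_k)]; its length is [size p]. *)
Fixpoint is_walk u (p : seq (edge G * vertex G)) : bool :=
  if p is (e, v) :: q then joins e u v && is_walk v q else true.

Definition walk_edges (p : seq (edge G * vertex G)) : seq (edge G) :=
  [seq ev.1 | ev <- p].

Definition walk_verts (p : seq (edge G * vertex G)) : seq (vertex G) :=
  [seq ev.2 | ev <- p].

Definition connected_in s t : Prop :=
  exists p, is_walk s p /\ last s (walk_verts p) = t.

Definition is_simple_path s t (p : seq (edge G * vertex G)) : bool :=
  [&& is_walk s p, last s (walk_verts p) == t & uniq (s :: walk_verts p)].

(* For s = t the only simple path is the empty one. *)
Definition simple_paths s t : {set {set edge G}} :=
  [set S : {set edge G} |
    `[< exists2 p, is_simple_path s t p & S = [set e in walk_edges p]%SET >]]%SET.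

(* Distinctness of the edges only matters for length 2, where it excludes going
   back and forth along a single edge. *)
Definition is_cycle v (p : seq (edge G * vertex G)) : bool :=
  [&& (0 < size p)%N, is_walk v p, last v (walk_verts p) == v,
      uniq (walk_verts p) & uniq (walk_edges p)].

End Paths.

Section Games.
Variables (R : realType) (G : multigraph).

(* A function on the nonnegative reals is represented by a total [c : R -> R]
   whose values at negative arguments are never used. Differentiability at the
   boundary point 0 is one-sided. *)
Record admissible_cost (c : R -> R) : Prop := AdmissibleCost {
  cost_ge0 : forall x : R, 0 <= x -> 0 <= c x;
  cost_incr : {in `[0, +oo[ &, {homo c : x y / x < y}};
  cost_derivable : forall x : R, 0 < x -> derivable c x 1;
  cost_derivable0 : cvg (h^-1 * (c h - c 0) @[h --> 0^'+]);
  cost_convex : @convex_function R R^o `[0, +oo[%classic c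
}.

Record game := Game {
  player : finType;
  weight : player -> R;
  source : player -> vertex G;
  sink : player -> vertex G;
  cost : player -> edge G -> R -> R;
  weight_ge0 : forall i, 0 <= weight i;
  source_sink_connected : forall i, connected_in (source i) (sink i);
  cost_admissible : forall i e, admissible_cost (cost i e)
}.

Variable Ga : game.
Implicit Types (i : player Ga) (e : edge G).

Definition allowable i : {set {set edge G}} := simple_paths (source i) (sink i).

(* A vector indexed by [allowable i] is extended by 0 to all sets of edges. *)
Definition is_strategy i (z : {set edge G} -> R) : Prop :=
  [/\ forall S, 0 <= z S,
      forall S, S \notin allowable i -> z S = 0
    & \sum_(S in allowable i) z S = weight i].

Definition profile := player Ga -> {set edge G} -> R.

Implicit Types x y : profile.

Definition player_load x i e : R :=
  \sum_(S in allowable i | e \in S) x i S.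

Definition load x e : R := \sum_i player_load x i e.

Definition player_cost x i : R :=
  \sum_e cost i e (load x e) * player_load x i e.

Definition is_equilibrium x : Prop :=
  (forall i, is_strategy i (x i)) /\
  (forall i z, is_strategy i z ->
     player_cost x i <= player_cost [eta x with i |-> z] i).

Definition different x y : Prop :=
  exists i e, player_load x i e <> player_load y i e.

Definition unique_equilibria : Prop :=
  ~ exists x y, [/\ is_equilibrium x, is_equilibrium y & different x y].

End Games.

Definition uniqueness_property (R : realType) (G : multigraph) : Prop :=
  forall Ga : game R G, unique_equilibria Ga.

(* Main.v *)
Require Import Defs.
From mathcomp Require Import all_boot all_order all_algebra.
From mathcomp Require Import all_classical all_reals all_analysis.
From mathcomp Require Import zify ring lra.

(** If no cycle has length 3 or more, all simple paths between two given vertices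
    meet every class of parallel edges in the same number (0 or 1) of edges, and
    an edge of a path may be exchanged for a parallel one. Hence, at an
    equilibrium, each player equalizes her marginal costs within each class, so
    every class behaves like a game on parallel links. There, comparing the
    multipliers of two equilibria as in Orda, Rom and Shimkin shows that the total
    loads agree, and then that the individual loads agree.

    Conversely, a cycle of length 3 or more splits into three arcs. For each arc,
    take two unit-weight players travelling between its ends. A player who moves
    to the complementary arc loads the arcs of the four others, which pushes them
    to move as well; for suitable affine costs both "everybody on her own arc" and
    "everybody on the complementary arc" are equilibria. *)

Set Implicit Arguments.
Unset Strict Implicit.
Unset Printing Implicit Defensive.

Import Order.TTheory GRing.Theory Num.Theory.
Import numFieldNormedType.Exports.

(** * Walks and parallel edges *)

Section Walks.
Variable G : multigraph.
Implicit Types (u v s t a b : vertex G) (e f : edge G).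
Implicit Types (p q : seq (edge G * vertex G)).

Definition ends_set e : {set vertex G} := [set (ends e).1; (ends e).2]%SET.

Definition parallel_class e : {set edge G} :=
  [set f | ends_set f == ends_set e]%SET.

Lemma joinsC e u v : joins e u v = joins e v u.
Proof. by rewrite /joins orbC. Qed.

Lemma joinsE e u v : joins e u v = (ends_set e == [set u; v]%SET).
Proof.
rewrite /joins /ends_set; case: (ends e) => a b /=; rewrite !xpair_eqE.
apply/idP/eqP => [/orP[]/andP[/eqP-> /eqP->] //|]; first by rewrite finset.setUC.
move=> E.
have := set21 a b; have := set22 a b; rewrite E !inE.
have := set21 u v; have := set22 u v; rewrite -E !inE.
rewrite ![u == _]eq_sym ![v == _]eq_sym.
by case: (a == u) (a == v) (b == u) (b == v) => [] [] [] [].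
Qed.

Lemma joins_end e u v a b : joins e u v -> joins e a b -> (a == u) || (a == v).
Proof.
rewrite !joinsE => /eqP -> /eqP E.
by have := set21 a b; rewrite -E !inE.
Qed.

Lemma walk_edge_vert u p e a b : is_walk u p -> e \in walk_edges p ->
  joins e a b -> a \in u :: walk_verts p.
Proof.
elim: p u => [//|[f v] p IH] u /= /andP[juv wp].
rewrite inE => /orP[/eqP ->|ep] jab.
  by rewrite !inE orbA (joins_end juv jab).
by rewrite inE; apply/orP; right; apply: IH.
Qed.

(** A later edge parallel to the first one would bring the walk back to its starting vertex. *)
Lemma uniq_ends_set u p : is_walk u p -> uniq (u :: walk_verts p) ->
  uniq [seq ends_set e | e <- walk_edges p].
Proof.
elim: p u => [//|[f v] p IH] u /= /andP[juv wp] /andP[uN up].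
rewrite (IH v) // andbT; apply/mapP => -[e ep E].
have je : joins e u v by rewrite joinsE -E -joinsE.
by move: uN; rewrite (walk_edge_vert wp ep je).
Qed.

Lemma is_walk_cat u p q :
  is_walk u (p ++ q) = is_walk u p && is_walk (last u (walk_verts p)) q.
Proof. by elim: p u => [//|[f v] p IH] u /=; rewrite IH andbA. Qed.

Lemma walk_verts_cat p q : walk_verts (p ++ q) = walk_verts p ++ walk_verts q.
Proof. exact: map_cat. Qed.

Lemma walk_edges_cat p q : walk_edges (p ++ q) = walk_edges p ++ walk_edges q.
Proof. exact: map_cat. Qed.

Lemma simple_path_setP s t (S : {set edge G}) :
  reflect (exists2 p, is_simple_path s t p & S = [set e in walk_edges p]%SET)
          (S \in simple_paths s t).
Proof. by rewrite inE; apply: asboolP. Qed.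

Lemma parallel_in_simple_path s t S e f : S \in simple_paths s t ->
  e \in S -> f \in S -> ends_set e = ends_set f -> e = f.
Proof.
move=> /simple_path_setP[p /and3P[wp _ up] ->]; rewrite !inE => ep fp E.
have /allP uc : all (fun g => (ends_set g == ends_set e) ==> (g == e)) (walk_edges p).
  elim: (walk_edges p) (uniq_ends_set wp up) ep => //= g l IH /andP[gN ul].
  rewrite inE => /orP[/eqP eg|el].
    rewrite eg !eqxx /=; apply/allP => h hl; apply/implyP => /eqP E'.
    by move: gN; rewrite -E' map_f.
  rewrite IH // andbT; apply/implyP => /eqP E'.
  by move: gN; rewrite E' map_f.
by have /implyP/(_ _)/eqP -> := uc _ fp; rewrite ?E.
Qed.

(** Substituting [f] for [e] along the walk keeps its vertices, so the path stays simple. *)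
Lemma swap_parallel s t S e f : S \in simple_paths s t -> e \in S ->
  ends_set e = ends_set f -> f |: (S :\ e) \in simple_paths s t.
Proof.
move=> Sst eS E.
case/simple_path_setP: (Sst) => p /and3P[wp lp up] defS.
pose sw g := if g == e then f else g.
have joins_sw g a b : joins (sw g) a b = joins g a b.
  by rewrite /sw; case: eqP => // ->; rewrite !joinsE E.
apply/simple_path_setP; exists [seq (sw ev.1, ev.2) | ev <- p].
  have V : walk_verts [seq (sw ev.1, ev.2) | ev <- p] = walk_verts p.
    by rewrite /walk_verts -map_comp.
  rewrite /is_simple_path V lp up !andbT.
  by elim: (p) (s) wp {lp up defS} => //= -[g v] q IH u /= /andP[jg wq];
    rewrite joins_sw jg IH.
have -> : walk_edges [seq (sw ev.1, ev.2) | ev <- p] = map sw (walk_edges p).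
  by rewrite /walk_edges -!map_comp.
apply/setP => g; rewrite !inE.
apply/idP/mapP => [/orP[/eqP->|/andP[ge gS]]|[h hp ->]].
- by exists e; [move: eS; rewrite defS inE | rewrite /sw eqxx].
- exists g; first by move: gS; rewrite defS inE.
  by rewrite /sw (negPf ge).
- rewrite /sw; case: (h =P e) => [_|/eqP he]; first by rewrite eqxx.
  by rewrite he defS inE hp orbT.
Qed.

(** * Connectivity outside one class of parallel edges *)

Section Avoid.
Variable c : {set vertex G}.

Definition avoid_adj a b := [exists f, joins f a b && (ends_set f != c)].

Lemma avoid_connect_sym : connect_sym avoid_adj.
Proof.
apply: sym_connect_sym => a b.
by apply: eq_existsb => f; rewrite joinsC.
Qed.

Lemma walk_avoid_connect u p : is_walk u p ->
  c \notin [seq ends_set e | e <- walk_edges p] ->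
  connect avoid_adj u (last u (walk_verts p)).
Proof.
elim: p u => [|[f v] p IH] u /=; first by rewrite connect0.
move=> /andP[juv wp]; rewrite inE negb_or => /andP[cf cp].
apply: connect_trans (IH _ wp cp); apply: connect1.
by apply/existsP; exists f; rewrite juv eq_sym.
Qed.

Lemma avoid_path_walk u vs : path avoid_adj u vs -> exists p,
  [/\ is_walk u p, walk_verts p = vs &
      c \notin [seq ends_set e | e <- walk_edges p]].
Proof.
elim: vs u => [|v vs IH] u /=; first by exists [::].
move=> /andP[/existsP[f /andP[jf fc]] /IH[p [wp <- cp]]].
exists ((f, v) :: p); split=> //=; first by rewrite jf.
by rewrite inE negb_or cp andbT eq_sym.
Qed.

End Avoid.

Definition no_long_cycle := ~ exists v p, is_cycle v p /\ (3 <= size p)%N.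

(** A simple path from [a] to [v] avoiding the class of [e] is closed up by [e]. It has at least two
    edges, since a single one would be parallel to [e]. *)
Lemma long_cycle_from_avoiding_path e a v :
  joins e a v -> a != v -> connect (avoid_adj (ends_set e)) a v ->
  exists p, is_cycle a p /\ (3 <= size p)%N.
Proof.
move=> jav nav /connectP[vs0 pvs0 lastv].
case/shortenP: pvs0 lastv => vs pvs uvs _ lastv.
have [p [wp defvs cp]] := avoid_path_walk pvs.
have size_vs : (2 <= size vs)%N.
  case: vs pvs uvs lastv {defvs} => [|w [|//]] /=.
    by move=> _ _ E; rewrite E eqxx in nav.
  rewrite andbT => /existsP[f /andP[jf]] + _ E.
  by move: jf jav; rewrite E !joinsE => /eqP -> /eqP ->; rewrite eqxx.
exists (p ++ [:: (e, a)]); split.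
  rewrite /is_cycle size_cat addn1 is_walk_cat walk_verts_cat walk_edges_cat.
  rewrite wp defvs -lastv /= joinsC jav last_cat /= eqxx /=.
  rewrite cats1 rcons_uniq -cons_uniq uvs /=.
  apply: (@map_uniq _ _ ends_set); rewrite map_cat cats1 rcons_uniq cp /=.
  by apply: uniq_ends_set wp _; rewrite defvs.
by rewrite size_cat addn1 -(size_map snd p) -/(walk_verts p) defvs.
Qed.

(** Otherwise the two ends of [e] are connected outside its class: from one end back along [S] to
    [s], along [S'] to [t], then back along [S] to the other end. This yields a long cycle. *)
Lemma parallel_edge_in_path s t S S' e : no_long_cycle ->
  S \in simple_paths s t -> S' \in simple_paths s t -> e \in S ->
  exists2 f, f \in S' & ends_set f = ends_set e.
Proof.
move=> noC /simple_path_setP[p /and3P[wp /eqP lp up] ->].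
move=> /simple_path_setP[q /and3P[wq /eqP lq _] ->].
rewrite inE => /mapP[[e' v] evp /= ?]; subst e'.
have [|cq] := boolP (ends_set e \in [seq ends_set f | f <- walk_edges q]).
  by case/mapP => f fq ->; exists f; rewrite // inE.
case: noC; exists (last s (walk_verts (take (index (e, v) p) p))).
have uc := uniq_ends_set wp up; move: uc wp lp up.
case/splitPr: evp => p1 p2 => uc wp lp up.
rewrite index_cat /=.
(* [index] finds the first occurrence; one already in [p1] would repeat the class of [e] on a simple
   path. *)
case: ifP => [ep1|_].
  move: uc; rewrite walk_edges_cat map_cat cat_uniq => /and3P[_ /hasPn/(_ (ends_set e))].
  by rewrite /= inE eqxx => /(_ isT); rewrite map_f // (map_f fst ep1).
rewrite eqxx addn0 take_size_cat //; set a := last s _.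
move: wp lp; rewrite is_walk_cat walk_verts_cat /= -/a last_cat /=.
move=> /and3P[wp1 jav wp2] lp2.
apply: (@long_cycle_from_avoiding_path e _ v) => //.
  move: up; rewrite walk_verts_cat -cat_cons cat_uniq => /and3P[_ /hasPn/(_ v)].
  rewrite /= inE eqxx => /(_ isT) vN _.
  by apply: contraNneq vN => <-; rewrite /a mem_last.
move: uc; rewrite walk_edges_cat map_cat cat_uniq /= negb_or.
move=> /and3P[_ /andP[c1 _] /andP[c2 _]].
have sa := walk_avoid_connect wp1 c1.
have vt := walk_avoid_connect wp2 c2.
have st := walk_avoid_connect wq cq.
rewrite avoid_connect_sym in sa.
apply: connect_trans sa _; rewrite avoid_connect_sym in vt.
by apply: connect_trans vt; rewrite lp2 -lq.
Qed.

Lemma card_parallel_class s t S S' e : no_long_cycle ->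
  S \in simple_paths s t -> S' \in simple_paths s t ->
  #|S :&: parallel_class e| = #|S' :&: parallel_class e|.
Proof.
move=> noC; move: S S'.
suff le_card S S' : S \in simple_paths s t -> S' \in simple_paths s t ->
    (#|S :&: parallel_class e| <= #|S' :&: parallel_class e|)%N.
  by move=> S S' pS pS'; apply/eqP; rewrite eqn_leq !le_card.
move=> pS pS'.
have [/eqP -> |] := boolP (#|S :&: parallel_class e| == 0)%N => //.
rewrite -lt0n => /card_gt0P[f]; rewrite !inE => /andP[fS /eqP fe].
have -> : S :&: parallel_class e = [set f]%SET.
  apply/setP => g; rewrite !inE; apply/andP/eqP => [[gS /eqP ge]|->]; last by rewrite fe eqxx.
  by apply: (parallel_in_simple_path pS) => //; rewrite ge fe.
have [g gS' gf] := parallel_edge_in_path noC pS pS' fS.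
rewrite cards1 card_gt0; apply/set0Pn; exists g.
by rewrite !inE gS' gf fe eqxx.
Qed.

End Walks.

(** * Arcs of a cycle *)

Section Reversal.
Variable G : multigraph.
Implicit Types (u v s t a b : vertex G) (e f : edge G).
Implicit Types (p q : seq (edge G * vertex G)).

Lemma joins_inv e a b (c d : vertex G) : joins e a b -> joins e c d ->
  (c, d) = (a, b) \/ (c, d) = (b, a).
Proof.
rewrite /joins => /orP[]/eqP -> /orP[]/eqP[-> ->]; by [left|right].
Qed.

Fixpoint rev_walk u p : seq (edge G * vertex G) :=
  if p is (e, v) :: q then rcons (rev_walk v q) (e, u) else [::].

Lemma rev_walk_verts u p : last u (walk_verts p) :: walk_verts (rev_walk u p) =
  rev (u :: walk_verts p).
Proof.
elim: p u => [//|[e v] p IH] u /=.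
have vr q ev : walk_verts (rcons q ev) = rcons (walk_verts q) ev.2 by exact: map_rcons.
by rewrite vr -rcons_cons IH [RHS]rev_cons.
Qed.

Lemma rev_walk_edges u p : walk_edges (rev_walk u p) = rev (walk_edges p).
Proof.
elim: p u => [//|[e v] p IH] u /=.
have er q ev : walk_edges (rcons q ev) = rcons (walk_edges q) ev.1 by exact: map_rcons.
by rewrite er IH rev_cons.
Qed.

Lemma last_rev_walk u p :
  last (last u (walk_verts p)) (walk_verts (rev_walk u p)) = u.
Proof.
rewrite -[LHS]/(last u (last u (walk_verts p) :: walk_verts (rev_walk u p))).
by rewrite rev_walk_verts rev_cons last_rcons.
Qed.

Lemma is_walk_rev u p : is_walk u p ->
  is_walk (last u (walk_verts p)) (rev_walk u p).
Proof.
elim: p u => [//|[e v] p IH] u /= /andP[je wp].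
by rewrite -cats1 is_walk_cat IH //= last_rev_walk joinsC je.
Qed.

Lemma simple_paths_sym s t : simple_paths s t = simple_paths t s.
Proof.
suff sub u v S : S \in simple_paths u v -> S \in simple_paths v u.
  by apply/setP => S; apply/idP/idP; apply: sub.
move=> /simple_path_setP[p /and3P[wp /eqP lp up] ->].
apply/simple_path_setP; exists (rev_walk u p).
  by rewrite /is_simple_path -lp is_walk_rev // last_rev_walk eqxx /=
     -cons_uniq rev_walk_verts rev_uniq.
by apply/setP => e; rewrite !inE rev_walk_edges mem_rev.
Qed.

(** Cut argument: a walk that enters or leaves [W] must use an edge with exactly one end in [W]. *)
Lemma walk_invariant u p (W : {set vertex G}) : is_walk u p ->
  (forall e a b, e \in walk_edges p -> joins e a b -> (a \in W) = (b \in W)) ->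
  (u \in W) = (last u (walk_verts p) \in W).
Proof.
elim: p u => [//|[e v] p IH] u /= /andP[je wp] inv.
rewrite (inv e u v) ?inE ?eqxx //; apply: IH => // f a b fp.
by apply: inv; rewrite inE fp orbT.
Qed.

End Reversal.

(** * Arcs of a cycle, indexed modulo its length *)

Section CyclicArcs.
Variables (G : multigraph) (k : nat) (w : nat -> vertex G) (g : nat -> edge G).
Hypothesis w_eq : forall i j, (w i == w j) = (i == j %[mod k]).
Hypothesis g_eq : forall i j, (g i == g j) = (i == j %[mod k]).
Hypothesis w_joins : forall i, joins (g i) (w i) (w i.+1).

Lemma eq_mod_window m i j : i = j %[mod k] -> (m <= i < m + k)%N ->
  (m <= j < m + k)%N -> i = j.
Proof.
wlog le_ij : i j / (i <= j)%N => [H|].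
  by case/orP: (leq_total i j) => le E ? ?; [apply: H | apply/esym/H].
move=> /esym/eqP; rewrite eqn_mod_dvd // => /dvdnP[[|q]]; lia.
Qed.

Lemma mod_window m r : (0 < k)%N ->
  exists2 i, (m <= i < m + k)%N & i = r %[mod k].
Proof.
(* [m * k.-1] plays the role of [- m] modulo [k]. *)
move=> k0; exists (m + (r + m * k.-1) %% k).
  by rewrite leq_addr ltn_add2l ltn_mod.
by rewrite modnDmr addnCA -mulnS prednK // addnC modnMDl.
Qed.

(** Indices are not reduced modulo [k], so an arc may run past the starting point of the cycle. *)
Definition arc i l : seq (edge G * vertex G) :=
  [seq (g m, w m.+1) | m <- iota i l].

Definition arc_set i l : {set edge G} := [set e in map g (iota i l)]%SET.

Lemma walk_edges_arc i l : walk_edges (arc i l) = map g (iota i l).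
Proof. by rewrite /walk_edges -map_comp. Qed.

Lemma walk_verts_arc i l : w i :: walk_verts (arc i l) = map w (iota i l.+1).
Proof.
rewrite /= /walk_verts -map_comp; congr (_ :: _).
by rewrite -(add1n i) iotaDl -map_comp; apply: eq_map.
Qed.

Lemma is_walk_arc i l : is_walk (w i) (arc i l).
Proof. by elim: l i => //= l IH i; rewrite w_joins IH. Qed.

Lemma last_arc i l : last (w i) (walk_verts (arc i l)) = w (i + l).
Proof.
by elim: l i => [|l IH] i /=; rewrite ?addn0 // -/(arc _ _) IH addSnnS.
Qed.

Lemma arc_simple i l : (l < k)%N -> arc_set i l \in simple_paths (w i) (w (i + l)).
Proof.
move=> lk; apply/simple_path_setP; exists (arc i l); last by rewrite walk_edges_arc.
rewrite /is_simple_path is_walk_arc last_arc eqxx walk_verts_arc.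
rewrite map_inj_in_uniq ?iota_uniq // => m n; rewrite !mem_iota => m_l n_l.
by move=> /eqP; rewrite w_eq => /eqP/(@eq_mod_window i); apply; lia.
Qed.

Lemma arc_setP i l e :
  reflect (exists2 m, (i <= m < i + l)%N & e = g m) (e \in arc_set i l).
Proof.
rewrite inE; apply: (iffP mapP) => -[m].
  by rewrite mem_iota => ? ->; exists m.
by move=> ? ->; exists m; rewrite ?mem_iota.
Qed.

Lemma full_arc_shift i j : (0 < k)%N -> arc_set i k = arc_set j k.
Proof.
move=> k0; suff sub a b : arc_set a k \subset arc_set b k.
  by apply/eqP; rewrite finset.eqEsubset !sub.
apply/fintype.subsetP => e /arc_setP[m _ ->].
have [n nb nm] := mod_window b m k0; apply/arc_setP; exists n => //.
by apply/eqP; rewrite g_eq nm.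
Qed.

Lemma full_arcD i l : (l <= k)%N ->
  (arc_set i k :\: arc_set i l)%SET = arc_set (i + l) (k - l).
Proof.
move=> lk; apply/setP => e; rewrite finset.in_setD; apply/andP/arc_setP.
  move=> [nl /arc_setP[m mk em]]; exists m => //.
  have : ~~ (i <= m < i + l)%N by apply: contraNN nl => ?; apply/arc_setP; exists m.
  lia.
move=> [m mk ->]; split; last by apply/arc_setP; exists m => //; lia.
apply/arc_setP => -[n nl /eqP]; rewrite g_eq => /eqP/(@eq_mod_window i).
lia.
Qed.

(** The arc from [w (i + l)] on to [w (i + k) = w i], traversed backwards. *)
Lemma arc_co_simple i l : (0 < l)%N -> (l <= k)%N ->
  arc_set (i + l) (k - l) \in simple_paths (w i) (w (i + l)).
Proof.
move=> l0 lk; rewrite simple_paths_sym.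
have -> : w i = w (i + l + (k - l)).
  by apply/eqP; rewrite w_eq -addnA subnKC // modnDr.
by apply: arc_simple; lia.
Qed.

(* Deleting from the cycle one edge of each arc between [w i] and [w (i + l)]
   disconnects these two vertices. *)
Lemma path_in_cycle_contains_arc i l S :
  (0 < l < k)%N -> S \in simple_paths (w i) (w (i + l)) ->
  S \subset arc_set i k ->
  arc_set i l \subset S \/ arc_set (i + l) (k - l) \subset S.
Proof.
move=> /andP[l0 lk] /simple_path_setP[p /and3P[wp /eqP lp up] defS] SU.
have [?|] := boolP (arc_set i l \subset S); first by left.
have [? _|] := boolP (arc_set (i + l) (k - l) \subset S); first by right.
move=> /fintype.subsetPn[_ /arc_setP[n nl ->] nS] /fintype.subsetPn[_ /arc_setP[m ml ->] mS].
(* Here [m < i + l <= n < m + k]. The edges [g m] and [g n], both missed by [S], are the only cycle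
   edges leaving [W], which contains [w (i + l)] but not [w i]. *)
pose W : {set vertex G} := [set a in map w (iota m.+1 (n - m))]%SET.
have inW a : reflect (exists2 q, (m < q <= n)%N & a = w q) (a \in W).
  rewrite inE; apply: (iffP mapP) => -[q qmn ->]; exists q => //.
    by move: qmn; rewrite mem_iota; lia.
  by rewrite mem_iota; lia.
have notW q : (n < q <= m + k)%N -> w q \notin W.
  move=> qn; apply/inW => -[r rmn /eqP]; rewrite w_eq => /eqP.
  by move/(@eq_mod_window m.+1); lia.
have iW : w i \notin W.
  have -> : w i = w (i + k) by apply/eqP; rewrite w_eq modnDr.
  by apply: notW; lia.
have /negP[] := iW; rewrite (walk_invariant (W := W) wp) ?lp.
  by apply/inW; exists (i + l) => //; lia.
move=> e a b ep jab.
have eS : e \in S by rewrite defS inE.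
have /arc_setP[r0 _ er0] := fintype.subsetP SU _ eS.
have k0 : (0 < k)%N by lia.
have [r rmk rr0] := mod_window m r0 k0.
have er : e = g r by rewrite er0; apply/eqP; rewrite g_eq rr0.
have rm : r != m by apply: contraNneq mS => <-; rewrite -er.
have rn : r != n by apply: contraNneq nS => <-; rewrite -er.
suff eqW : (w r \in W) = (w r.+1 \in W).
  have jr : joins e (w r) (w r.+1) by rewrite er.
  by case: (joins_inv jr jab) => -[-> ->].
have [rn'|rn'] := ltnP r n.
  by transitivity true; [apply/inW; exists r => //; lia|
     apply/esym/inW; exists r.+1 => //; lia].
by transitivity false; [apply/negbTE/notW; lia|
     apply/esym/negbTE/notW; lia].
Qed.

End CyclicArcs.

(** * Splitting a cycle into three arcs *)

Section ThreeArcs.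
Variable G : multigraph.

(* [tau] splits the edges of the cycle into three arcs; [None] marks the edges
   that are not on the cycle. *)
Definition arc_of (tau : edge G -> option 'I_3) j : {set edge G} :=
  [set e | tau e == Some j]%SET.

Definition co_arc_of (tau : edge G -> option 'I_3) j : {set edge G} :=
  [set e | (tau e != None) && (tau e != Some j)]%SET.

(** All that the construction of the game needs from the cycle. The last field bounds from below the
    cost of every path that stays on the cycle. *)
Record three_arcs (tau : edge G -> option 'I_3) (src snk : 'I_3 -> vertex G) :
    Prop := ThreeArcs {
  arc_nonempty : forall j, exists e, tau e = Some j;
  arc_path : forall j, arc_of tau j \in simple_paths (src j) (snk j);
  co_arc_path : forall j, co_arc_of tau j \in simple_paths (src j) (snk j);
  arc_or_co_arc : forall j S, S \in simple_paths (src j) (snk j) ->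
    (forall e, e \in S -> tau e != None) ->
    arc_of tau j \subset S \/ co_arc_of tau j \subset S
}.

(** The arcs are the first edge, the second edge and the remaining [k - 2] edges; length at least 3
    makes the last one nonempty. *)
Lemma cycle_three_arcs (v : vertex G) p : is_cycle v p -> (3 <= size p)%N ->
  exists tau src snk, three_arcs tau src snk.
Proof.
move=> /and5P[_ wp /eqP lp uv ue] k3; set k := size p in k3.
have [e0 _] : exists e0 : edge G, True.
  by move: k3; rewrite /k; case: (p) => // -[e ?] ? _; exists e.
have k0 : (0 < k)%N by lia.
have size_v : size (walk_verts p) = k by rewrite size_map.
have size_e : size (walk_edges p) = k by rewrite size_map.
(* [walk_verts p] lists the heads of the edges, so [w i] is the tail
   of edge [i]. *)
pose w i := nth v (walk_verts p) ((i + k.-1) %% k).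
pose g i := nth e0 (walk_edges p) (i %% k).
have w_eq i j : (w i == w j) = (i == j %[mod k]).
  by rewrite nth_uniq ?size_v ?ltn_mod // eqn_modDr.
have g_eq i j : (g i == g j) = (i == j %[mod k]).
  by rewrite nth_uniq ?size_e ?ltn_mod.
have step (q : seq (edge G * vertex G)) u m : is_walk u q -> (m < size q)%N ->
    joins (nth e0 (walk_edges q) m) (nth v (u :: walk_verts q) m)
          (nth v (walk_verts q) m).
  elim: q u m => [//|[e a] q IH] u [|m] /= /andP[je wq] mq; first exact: je.
  exact: IH.
have w_joins i : joins (g i) (w i) (w i.+1).
  have ik : (i %% k < k)%N by rewrite ltn_mod.
  have -> : w i.+1 = nth v (walk_verts p) (i %% k).
    by rewrite /w addSnnS prednK // modnDr.
  suff -> : w i = nth v (v :: walk_verts p) (i %% k) by exact: step.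
  rewrite /w -modnDml; case: (i %% k) ik => [|m] mk.
    by rewrite add0n modn_small ?prednK // -size_v nth_last.
  by rewrite addSnnS prednK // modnDr modn_small // ltnW.
pose U := arc_set g 0 k.
pose len (j : 'I_3) := if j == 2 :> nat then (k - 2)%N else 1%N.
pose tau e : option 'I_3 := if e == g 0 then Some (inord 0) else
  if e == g 1 then Some (inord 1) else if e \in U then Some (inord 2) else None.
have len_lt j : (0 < len j < k)%N by rewrite /len; case: ifP; lia.
have gU i : g i \in U.
  have [m mk mi] := mod_window 0 i k0; apply/arc_setP; exists m => //.
  by apply/eqP; rewrite g_eq mi.
have tau_U e : (tau e != None) = (e \in U).
  rewrite /tau; case: (e =P g 0) => [->|_]; first by rewrite gU.
  by case: (e =P g 1) => [->|_]; [rewrite gU | case: ifP].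
have g01 : g 1 != g 0 by rewrite g_eq !modn_small //; lia.
have arcE j : arc_of tau j = arc_set g j (len j).
  have eq_inord m : (m < 3)%N -> (Some (inord m) == Some j) = (m == j :> nat).
    by move=> m3; rewrite -[LHS]/(inord m == j) -val_eqE /= inordK.
  apply/setP => e; rewrite inE /tau.
  case: j eq_inord => [[|[|[|//]]] j3] eq_inord; rewrite /len /=.
  - rewrite /arc_set !inE; case: (e =P g 0) => _; first by rewrite eq_inord.
    case: (e =P g 1) => _; first by rewrite eq_inord.
    by case: ifP => // _; rewrite eq_inord.
  - rewrite /arc_set !inE; case: (e =P g 0) => [->|_].
      by rewrite eq_inord // [g 0 == g 1]eq_sym (negPf g01).
    case: (e =P g 1) => _; first by rewrite eq_inord.
    by case: ifP => // _; rewrite eq_inord.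
  - have -> : arc_set g 2 (k - 2) = (U :\: arc_set g 0 2)%SET.
      by rewrite (full_arcD g_eq) //; lia.
    rewrite finset.in_setD.
    rewrite [e \in arc_set g 0 2]inE /= !inE.
    case: (e =P g 0) => _; first by rewrite eq_inord.
    case: (e =P g 1) => _; first by rewrite eq_inord.
    by rewrite /=; case: ifP => // _; rewrite eq_inord.
have coE j : co_arc_of tau j = arc_set g (j + len j) (k - len j).
  rewrite -(full_arcD g_eq); last by have := len_lt j; lia.
  rewrite (full_arc_shift g_eq j 0 k0) -arcE; apply/setP => e.
  by rewrite finset.in_setD -tau_U !inE andbC.
exists tau, (fun j : 'I_3 => w j), (fun j : 'I_3 => w (j + len j)%N); split.
- move=> j; have [l0 lk] := andP (len_lt j).
  have : g j \in arc_of tau j.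
    by rewrite arcE; apply/arc_setP; exists j => //; lia.
  by rewrite inE => /eqP; exists (g j).
- by move=> j; rewrite arcE; apply: arc_simple => //; case/andP: (len_lt j).
- move=> j; rewrite coE; have [l0 lk] := andP (len_lt j).
  by apply: arc_co_simple => //; exact: ltnW.
- move=> j S Sj SU; rewrite arcE coE; apply: path_in_cycle_contains_arc => //.
  by rewrite (full_arc_shift g_eq j 0 k0); apply/fintype.subsetP => e /SU; rewrite tau_U.
Qed.

End ThreeArcs.

Local Open Scope ring_scope.

(** * Marginal costs *)

Section AdmissibleCosts.
Local Open Scope classical_set_scope.
Variables (R : realType) (c : R -> R).
Hypothesis adm : admissible_cost c.

(* The coefficient [b] is 0 whenever [a = 0] below, so the junk value of
   [derive1 c 0] is harmless. *)
Definition marginal (b a : R) : R := c a + b * derive1 c a.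

Lemma diff_quotient_cvg a : 0 < a ->
  h^-1 * (c (a + h) - c a) @[h --> 0^'] --> derive1 c a.
Proof.
move=> a0; have := cost_derivable adm a0.
rewrite /derivable derive1E /derive => /cvg_ex[l /= cl].
rewrite (cvg_lim _ cl) //.
apply: cvg_trans cl; apply: near_eq_cvg; near=> h.
by rewrite /= scaler1 [h + a]addrC.
Unshelve. all: by end_near.
Qed.

Lemma convex_cost_le (x y t : R) : 0 <= x -> 0 <= y -> 0 <= t -> t <= 1 ->
  c (x + t * (y - x)) <= c x + t * (c y - c x).
Proof.
move=> x0 y0 t0 t1.
have in_dom (z : R) : 0 <= z ->
    (z : convex_lmodType R^o) \in `[0%R, +oo[%classic.
  by move=> z0; rewrite inE /= in_itv /= z0.
have := cost_convex adm (Itv01 t0 t1) (in_dom _ y0) (in_dom _ x0).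
rewrite convRE /= /unstable.onem => le_conv.
have -> : x + t * (y - x) = t * y + (1 - t) * x by ring.
by apply: le_trans le_conv _; rewrite le_eqVlt; apply/orP; left; apply/eqP; ring.
Qed.

(** Turns the two-sided derivative into a limit over [h] decreasing to 0 along a direction [u] of
    either sign. *)
Lemma scaled_cvg_dnbhs0 (u : R) : u != 0 -> h * u @[h --> 0^'+] --> (0 : R)^'.
Proof.
move=> u0.
have lim0 : h * u @[h --> (0 : R)^'+] --> (0 : R).
  rewrite -[X in _ --> X](mul0r u); apply: cvg_at_right_filter.
  by apply: cvgMr_tmp; exact: cvg_id.
move=> A A0; apply: filterS2 (nbhs_right_gt (0 : R)) (lim0 _ A0) => h h0.
by apply; rewrite mulf_neq0 // gt_eqF.
Qed.

(** By convexity, every difference quotient from [a] towards [y] is at most [c y - c a]; the bound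
    passes to the limit. *)
Lemma tangent_le a y : 0 < a -> 0 <= y -> c a + derive1 c a * (y - a) <= c y.
Proof.
move=> a0 y0; have [->|ya] := eqVneq y a; first by rewrite subrr mulr0 addr0.
have u0 : y - a != 0 by rewrite subr_eq0.
rewrite -lerBrDl.
have lim_slope : (y - a) * ((h * (y - a))^-1 * (c (a + h * (y - a)) - c a))
    @[h --> 0^'+] --> (y - a) * derive1 c a.
  apply: cvgM; first exact: cvg_cst.
  exact: (cvg_comp _ _ (scaled_cvg_dnbhs0 u0) (diff_quotient_cvg a0)).
rewrite mulrC -(cvg_lim _ lim_slope) //; apply: limr_le.
  by apply: cvgP lim_slope.
near=> h.
have h0 : 0 < h by near: h; exact: nbhs_right_gt.
have h1 : h <= 1 by near: h; exact: nbhs_right_le.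
have -> : (y - a) * ((h * (y - a))^-1 * (c (a + h * (y - a)) - c a)) =
   h^-1 * (c (a + h * (y - a)) - c a) by field; rewrite u0 gt_eqF.
rewrite ler_pdivrMl // lerBlDl.
by apply: convex_cost_le => //; exact: ltW.
Unshelve. all: by end_near.
Qed.

(** At 0 the tangent at [a] lies below [c 0 < c a], so its slope is positive. *)
Lemma derive1_cost_gt0 a : 0 < a -> 0 < derive1 c a.
Proof.
move=> a0.
have T := tangent_le a0 (lexx 0).
have I : c 0 < c a by apply: (cost_incr adm); rewrite // in_itv /= ?lexx ?ltW.
have : 0 < derive1 c a * a by lra.
by rewrite pmulr_lgt0.
Qed.

(** Add the tangent inequality at [a] taken in [a'] to the one at [a'] taken in [a]. *)
Lemma derive1_cost_mono a a' : 0 < a -> a <= a' -> derive1 c a <= derive1 c a'.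
Proof.
move=> a0; rewrite le_eqVlt => /predU1P[-> //|aa'].
have a'0 := lt_trans a0 aa'.
have T1 := tangent_le a0 (ltW a'0).
have T2 := tangent_le a'0 (ltW a0).
have : 0 <= (derive1 c a' - derive1 c a) * (a' - a) by nra.
by rewrite pmulr_lge0 ?subr_gt0 // subr_ge0.
Qed.

Lemma marginal_ge0 b a : 0 <= b <= a -> 0 <= marginal b a.
Proof.
move=> /andP[b0 ba]; apply: addr_ge0.
  by apply: (cost_ge0 adm); exact: le_trans ba.
move: b0; rewrite le_eqVlt => /predU1P[<-|b0]; first by rewrite mul0r.
by rewrite mulr_ge0 ?ltW // derive1_cost_gt0 // (lt_le_trans b0).
Qed.

(** [c] and its derivative are monotone; strictness comes from [b < b'] and the positive derivative
    at [a']. *)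
Lemma marginal_lt b a b' a' : 0 <= b <= a -> b' <= a' -> a <= a' -> b < b' ->
  marginal b a < marginal b' a'.
Proof.
move=> /andP[b0 ba] ba' aa' bb'.
have b'0 : 0 < b' by exact: le_lt_trans bb'.
have a'0 : 0 < a' by exact: lt_le_trans ba'.
have a0 : 0 <= a by exact: le_trans ba.
have c_le : c a <= c a'.
  move: aa'; rewrite le_eqVlt => /predU1P[-> //|aa'].
  by apply: ltW; apply: (cost_incr adm); rewrite // in_itv /= ?a0 ?ltW.
rewrite /marginal; apply: ler_ltD => //.
have d0 := derive1_cost_gt0 a'0.
move: b0; rewrite le_eqVlt => /predU1P[<-|b0]; first by rewrite mul0r mulr_gt0.
have := derive1_cost_mono (lt_le_trans b0 ba) aa'; nra.
Qed.

Lemma cost_cvg0 : c h @[h --> 0^'+] --> c 0.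
Proof.
have /cvg_ex[l /= cl] := cost_derivable0 adm.
have lim_prod : h * (h^-1 * (c h - c 0)) + c 0 @[h --> 0^'+] --> 0 * l + c 0.
  apply: cvgD; last exact: cvg_cst.
  by apply: cvgM => //; apply: cvg_at_right_filter; exact: cvg_id.
rewrite mul0r add0r in lim_prod.
apply: cvg_trans lim_prod; apply: near_eq_cvg; near=> h.
have h0 : 0 < h by near: h; exact: nbhs_right_gt.
by rewrite mulrA mulfV ?gt_eqF // mul1r subrK.
Unshelve. all: by end_near.
Qed.

(** Product rule for a player's cost on one edge when her own load [b] and the total load [a] change
    by the same amount. Direction -1 is the one for removing load. *)
Lemma scaled_marginal_cvg b a u : 0 < a -> u != 0 ->
  h^-1 * (c (a + h * u) * (b + h * u) - c a * b) @[h --> 0^'+]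
    --> u * marginal b a.
Proof.
move=> a0 u0.
have lim1 : u * ((h * u)^-1 * (c (a + h * u) - c a)) * (b + h * u) + u * c a
    @[h --> 0^'+] --> u * derive1 c a * (b + 0) + u * c a.
  apply: cvgD; last exact: cvg_cst.
  apply: cvgM.
    apply: cvgM; first exact: cvg_cst.
    exact: (cvg_comp _ _ (scaled_cvg_dnbhs0 u0) (diff_quotient_cvg a0)).
  apply: cvgD; first exact: cvg_cst.
  exact: cvg_trans (scaled_cvg_dnbhs0 u0) (@nbhs_dnbhs _ _).
have -> : u * marginal b a = u * derive1 c a * (b + 0) + u * c a.
  by rewrite /marginal; ring.
apply: cvg_trans lim1; apply: near_eq_cvg; near=> h.
have h0 : 0 < h by near: h; exact: nbhs_right_gt.
by rewrite /=; field; rewrite u0 gt_eqF.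
Unshelve. all: by end_near.
Qed.

Lemma marginal_cvg b a : 0 <= b <= a ->
  h^-1 * (c (a + h) * (b + h) - c a * b) @[h --> 0^'+] --> marginal b a.
Proof.
move=> /andP[b0 ba].
have [a0|a0|a0] := ltgtP a 0; first by move: (le_trans b0 ba); rewrite leNgt a0.
  have := @scaled_marginal_cvg b a 1 a0 (oner_neq0 _); rewrite mul1r.
  by under eq_fun do rewrite mulr1.
(* At the boundary [a = b = 0] the quotient is just [c h], and right continuity of [c] at 0
   suffices. *)
have -> : b = 0 by apply/eqP; rewrite eq_le b0 -a0 ba.
rewrite a0 /marginal mul0r addr0.
apply: cvg_trans cost_cvg0; apply: near_eq_cvg; near=> h.
have h0 : 0 < h by near: h; exact: nbhs_right_gt.
by rewrite /= !add0r mulr0 subr0 mulrCA mulVf ?mulr1 // gt_eqF.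
Unshelve. all: by end_near.
Qed.

End AdmissibleCosts.

(** * Uniqueness *)

Section ParallelLinks.
Variables (R : realDomainType) (N E : finType) (C : {set E}).
Variable K : N -> E -> R -> R -> R.
Implicit Types (x y : N -> E -> R) (l : N -> R).

Hypothesis K_ge0 : forall i e (b a : R), 0 <= b <= a -> 0 <= K i e b a.
Hypothesis K_lt : forall i e (b a b' a' : R), 0 <= b <= a -> b' <= a' -> a <= a' ->
  b < b' -> K i e b a < K i e b' a'.

Let total x e := \sum_i x i e.

Definition link_equilibrium x : Prop :=
  (forall i e, 0 <= x i e) /\
  (forall i, {in C &, forall e f, 0 < x i e ->
     K i e (x i e) (total x e) <= K i f (x i f) (total x f)}).

Definition link_multiplier x l : Prop :=
  (forall i, {in C, forall e, l i <= K i e (x i e) (total x e)}) /\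
  (forall i, {in C, forall e, 0 < x i e -> l i = K i e (x i e) (total x e)}).

Lemma le_total x i e : (forall i e, 0 <= x i e) -> x i e <= total x e.
Proof. by move=> x0; rewrite /total (bigD1 i) //= lerDl sumr_ge0. Qed.

Lemma link_multiplier_exists x : link_equilibrium x -> exists l, link_multiplier x l.
Proof.
move=> [x0 eqx].
(* A player without load on [C] gets the multiplier 0, a lower bound because marginal costs are
   non-negative. *)
exists (fun i => if [pick e in C | 0 < x i e] is Some e
                 then K i e (x i e) (total x e) else 0).
split=> i e eC; case: pickP => [f /andP[fC xf]|no].
- exact: eqx.
- by rewrite K_ge0 // x0 le_total.
- by move=> xe; apply/eqP; rewrite eq_le !eqx.
- by move=> xe; move: (no e); rewrite eC xe.
Qed.

(** If [y i e] were larger, [e] would carry load in [y], so its marginal cost there would equal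
    [l' i]; but strict monotonicity makes it exceed the marginal cost in [x], hence [l i]. *)
Lemma load_le_of_multiplier_le x y l l' i e :
  link_equilibrium x -> link_multiplier x l ->
  link_equilibrium y -> link_multiplier y l' -> e \in C ->
  l' i <= l i -> total x e <= total y e -> y i e <= x i e.
Proof.
move=> [x0 _] [lx _] [y0 _] [_ ly] eC ll' xy; rewrite leNgt; apply/negP => lt_xy.
have : K i e (x i e) (total x e) < K i e (y i e) (total y e).
  by apply: K_lt => //; rewrite ?x0 le_total.
rewrite -ly // ?(le_lt_trans (x0 i e)) // ltNge => /negP; apply.
exact: le_trans (lx i e eC).
Qed.

Lemma link_total_le x y : link_equilibrium x -> link_equilibrium y ->
  (forall i, \sum_(e in C) x i e = \sum_(e in C) y i e) ->
  {in C, forall e, total y e <= total x e}.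
Proof.
move=> eqx eqy eq_sum e0 e0C; rewrite leNgt; apply/negP => lt_e0.
have [l lx] := link_multiplier_exists eqx.
have [l' ly] := link_multiplier_exists eqy.
pose L e := total x e < total y e.
(* On the links [L] whose total grows, no player gains load: if her multiplier does not grow, this
   holds link by link; otherwise she loses nothing outside [L], and her sum over [C] is fixed.
   Summing over the players contradicts the growth of the totals on [L]. *)
have le_L i : \sum_(e in C | L e) y i e <= \sum_(e in C | L e) x i e.
  have [ll'|/ltW ll'] := leP (l' i) (l i).
    apply: ler_sum => e /andP[eC Le].
    by apply: (load_le_of_multiplier_le eqx lx eqy ly) => //; exact: ltW.
  have le_nL : \sum_(e in C | ~~ L e) x i e <= \sum_(e in C | ~~ L e) y i e.
    apply: ler_sum => e /andP[eC]; rewrite -leNgt => Le.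
    exact: (load_le_of_multiplier_le eqy ly eqx lx).
  by move: (eq_sum i); rewrite (bigID L) [RHS](bigID L) /=; lra.
have : \sum_(e in C | L e) total y e <= \sum_(e in C | L e) total x e.
  by rewrite exchange_big [leRHS]exchange_big ler_sum.
rewrite leNgt => /negP; apply.
rewrite (bigD1 e0) /= ?e0C // [ltRHS](bigD1 e0) /= ?e0C //.
apply: ltr_leD => //; apply: ler_sum => e /andP[/andP[_ Le] _]; exact: ltW.
Qed.

(** Once totals agree, comparing the two multipliers of a player orders her loads the same way on
    all links, and equal sums turn this into equality. *)
Lemma link_equilibrium_unique x y : link_equilibrium x -> link_equilibrium y ->
  (forall i, \sum_(e in C) x i e = \sum_(e in C) y i e) ->
  forall i, {in C, forall e, x i e = y i e}.
Proof.
move=> eqx eqy eq_sum.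
have eq_total e : e \in C -> total x e = total y e.
  move=> eC; apply/eqP; rewrite eq_le.
  by rewrite (link_total_le eqx eqy) // (link_total_le eqy eqx).
have [l lx] := link_multiplier_exists eqx.
have [l' ly] := link_multiplier_exists eqy.
have eq_of_le (u v : E -> R) : \sum_(e in C) u e = \sum_(e in C) v e ->
    {in C, forall e, u e <= v e} -> {in C, forall e, u e = v e}.
  move=> eq_uv le_uv e eC; apply/eqP; rewrite -subr_eq0.
  have sum0 : \sum_(f in C) (v f - u f) = 0 by rewrite sumrB eq_uv subrr.
  rewrite -oppr_eq0 opprB; apply/eqP; apply: (psumr_eq0P _ sum0) => // f fC.
  by rewrite subr_ge0 le_uv.
move=> i e eC; have [ll'|/ltW ll'] := leP (l' i) (l i).
  apply/esym; apply: (eq_of_le (y i) (x i)) => // f fC.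
  by apply: (load_le_of_multiplier_le eqx lx eqy ly) => //; rewrite eq_total.
apply: (eq_of_le (x i) (y i)) => // f fC.
by apply: (load_le_of_multiplier_le eqy ly eqx lx) => //; rewrite eq_total.
Qed.

End ParallelLinks.

(** * Reduction of network equilibria to parallel links *)

Section GameLemmas.
Variables (R : realType) (G : multigraph) (Ga : game R G).
Implicit Types (i : player Ga) (e f g : edge G) (S : {set edge G}).
Implicit Types (x y : profile Ga) (z : {set edge G} -> R).

Definition path_load i z e : R := \sum_(S in allowable i | e \in S) z S.

Lemma path_load_ge0 i z e : is_strategy i z -> 0 <= path_load i z e.
Proof. by case=> z0 _ _; apply: sumr_ge0 => S _; exact: z0. Qed.

Lemma le_load x i e : (forall j, is_strategy j (x j)) ->
  player_load x i e <= load x e.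
Proof.
move=> sx; rewrite /load (bigD1 i) //= lerDl; apply: sumr_ge0 => j _.
exact: path_load_ge0.
Qed.

Lemma player_load_deviate x i z e :
  player_load [eta x with i |-> z] i e = path_load i z e.
Proof. by rewrite /player_load /= eqxx. Qed.

Lemma load_deviate x i z e :
  load [eta x with i |-> z] e = load x e + (path_load i z e - player_load x i e).
Proof.
rewrite /load (bigD1 i) //= [in RHS](bigD1 i) //= player_load_deviate.
under eq_bigr => j ji do rewrite /player_load /= (negPf ji) -/(player_load x j e).
by ring.
Qed.

(** Passes from edges to paths; used with marginal costs and with the indicator of a parallel
    class. *)
Lemma sum_path_load i z (w : edge G -> R) :
  \sum_e w e * path_load i z e =
  \sum_(S in allowable i) z S * \sum_(e in S) w e.
Proof.
under eq_bigr do rewrite /path_load mulr_sumr big_mkcondr /=.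
rewrite exchange_big /=; apply: eq_bigr => S _.
rewrite mulr_sumr [RHS]big_mkcond /=; apply: eq_bigr => e _.
by case: ifP => _ //; rewrite mulrC.
Qed.

Section Shift.
Variables (x : profile Ga) (i : player Ga) (S : {set edge G}) (e f : edge G).
Hypothesis sx : is_strategy i (x i).
Hypothesis Si : S \in allowable i.
Hypothesis eS : e \in S.
Hypothesis ef : ends_set e = ends_set f.
Hypothesis nef : e != f.

Let T := (f |: (S :\ e))%SET.

Let fS : f \notin S.
Proof.
apply/negP => fS; move: nef.
by rewrite (parallel_in_simple_path Si eS fS ef) eqxx.
Qed.

(** Moves the amount [h] from [S] to the path with [f] in place of [e], so that only the loads on
    [e] and [f] change. *)
Definition shift (h : R) (U : {set edge G}) : R :=
  x i U + h *+ (U == T) - h *+ (U == S).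

Let TS : T != S.
Proof. by apply: contraNneq fS => <-; rewrite setU11. Qed.

Let Ti : T \in allowable i.
Proof. exact: swap_parallel. Qed.

Let sum_delta (P : pred {set edge G}) U (h : R) :
  \sum_(V | P V) h *+ (V == U) = h *+ P U.
Proof.
rewrite big_mkcond (bigD1 U) //= eqxx big1 ?addr0; first by case: ifP.
by move=> V /negPf ->; case: ifP.
Qed.

Lemma shift_strategy h : 0 <= h <= x i S -> is_strategy i (shift h).
Proof.
case: sx => x0 xN xsum /andP[h0 hx]; split=> [U|U UN|].
- rewrite /shift; have [->|US] := eqVneq U S.
    by rewrite eq_sym (negPf TS) mulr0n mulr1n addr0 subr_ge0.
  by rewrite mulr0n subr0 addr_ge0 // mulrn_wge0.
- have /negPf UT : U != T by apply: contraNneq UN => ->.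
  have /negPf US : U != S by apply: contraNneq UN => ->.
  by rewrite /shift UT US xN // !mulr0n subr0 addr0.
- rewrite /shift sumrB big_split /= xsum !sum_delta.
  by rewrite Ti Si addrK.
Qed.

Lemma path_load_shift h g : path_load i (shift h) g =
  player_load x i g + h *+ (g == f) - h *+ (g == e).
Proof.
rewrite /path_load /shift sumrB big_split /= !sum_delta Ti Si /=.
rewrite -/(path_load i (x i) g) -addrA -[RHS]addrA; congr (_ + _).
rewrite !inE; have [->|gf] := eqVneq g f.
  by rewrite (negPf fS) eq_sym (negPf nef).
have [->|ge] /= := eqVneq g e; first by rewrite eS.
by rewrite !subrr.
Qed.

End Shift.

(** Moving a small amount [h] from [e] to [f] cannot pay off; dividing the change of cost by [h] and
    letting [h] tend to 0 gives the difference of the marginal costs. *)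
Lemma equilibrium_marginal_le x i e f : is_equilibrium x ->
  ends_set e = ends_set f -> 0 < player_load x i e ->
  marginal (cost i e) (player_load x i e) (load x e) <=
  marginal (cost i f) (player_load x i f) (load x f).
Proof.
move=> [sx optx] ef; have [-> //|nef] := eqVneq e f => xe.
have [S /andP[Si eS] xS] : exists2 S, (S \in allowable i) && (e \in S) & 0 < x i S.
  have [/forall_inP none|] := boolP [forall (S | (S \in allowable i) && (e \in S)), x i S <= 0].
    by move: xe; rewrite ltNge sumr_le0.
  by rewrite negb_forall_in => /exists_inP[S SP]; rewrite -ltNge => ?; exists S.
have xe_le := le_load i e sx; have xf_le := le_load i f sx.
have xf0 : 0 <= player_load x i f by exact: path_load_ge0.
have load0 : 0 < load x e by exact: lt_le_trans xe_le.
have minus1_neq0 : -1 != 0 :> R by rewrite oppr_eq0 oner_eq0.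
(* The load on [e] is positive, so load can be removed there; [f] may be empty, which only the
   version with direction 1 covers. *)
have lim_e := scaled_marginal_cvg (cost_admissible i e)
  (b := player_load x i e) load0 (minus1_neq0).
have lim_f := marginal_cvg (cost_admissible i f) (introT andP (conj xf0 xf_le)).
have /(_ (at_right_proper_filter 0)) lim := cvgD lim_e lim_f.
rewrite -subr_ge0 addrC -mulN1r -(cvg_lim _ lim) //.
apply: limr_ge; first exact: cvgP lim.
near=> h.
have h0 : 0 < h by near: h; exact: nbhs_right_gt.
have hS : h <= x i S by near: h; exact: nbhs_right_le.
have h0S : 0 <= h <= x i S by rewrite ltW.
rewrite -mulrDr mulr_ge0 ?invr_ge0 ?(ltW h0) //.
have := optx i _ (shift_strategy (sx i) Si eS ef nef h0S).
rewrite /player_cost (bigD1 e) // [leRHS](bigD1 e) //=.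
rewrite (bigD1 f) 1?eq_sym // [in leRHS](bigD1 f) 1?eq_sym //=.
under [in leRHS]eq_bigr => g /andP[ge gf].
  rewrite load_deviate player_load_deviate path_load_shift //.
  rewrite (negPf ge) (negPf gf) mulr0n addr0 subr0 subrr addr0; over.
rewrite !load_deviate !player_load_deviate !path_load_shift // !eqxx.
rewrite (negPf nef) eq_sym (negPf nef) /= !mulr0n !mulr1n.
set o := \sum_(_ | _) _.
have -> : player_load x i e + 0 - h - player_load x i e = h * -1 by ring.
have -> : player_load x i f + h - 0 - player_load x i f = h by ring.
rewrite addr0 subr0 -mulrN1 /= !fctE.
lra.
Unshelve. all: by end_near.
Qed.

Lemma equilibria_unique : no_long_cycle G -> unique_equilibria Ga.
Proof.
move=> noC [x [y [eqx eqy [i [e]]]]]; apply.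
pose K (j : player Ga) g := marginal (cost j g).
have link (u : profile Ga) : is_equilibrium u ->
    link_equilibrium (parallel_class e) K (player_load u).
  move=> eq_u; split=> [j g|j g g' gC g'C ug]; first exact: path_load_ge0 (eq_u.1 j).
  apply: (equilibrium_marginal_le eq_u) => //.
  by move: gC g'C; rewrite !inE => /eqP -> /eqP ->.
have K_ge0 j g (b a : R) : 0 <= b <= a -> 0 <= K j g b a.
  exact: (marginal_ge0 (cost_admissible j g)).
have K_lt j g (b a b' a' : R) : 0 <= b <= a -> b' <= a' -> a <= a' -> b < b' ->
    K j g b a < K j g b' a'.
  exact: (marginal_lt (cost_admissible j g)).
suff sums j : \sum_(g in parallel_class e) player_load x j g =
    \sum_(g in parallel_class e) player_load y j g.
  apply: (link_equilibrium_unique K_ge0 K_lt (link x eqx) (link y eqy) sums).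
  by rewrite inE.
have class_load z : \sum_(g in parallel_class e) path_load j z g =
    \sum_(S in allowable j) z S * #|S :&: parallel_class e|%:R.
  rewrite big_mkcond /=.
  transitivity (\sum_g (g \in parallel_class e)%:R * path_load j z g).
    by apply: eq_bigr => g _; case: ifP; rewrite ?mul1r ?mul0r.
  rewrite sum_path_load; apply: eq_bigr => S _; congr (_ * _).
  rewrite -sum1_card natr_sum [RHS]big_mkcond [LHS]big_mkcond.
  apply: eq_bigr => g _ /=; rewrite finset.in_setI.
  by case: (g \in S); case: (g \in parallel_class e).
rewrite [LHS]class_load [RHS]class_load.
have [S0 S0j|none] := pickP (mem (allowable j)); last first.
  by rewrite [LHS]big_pred0 ?[RHS]big_pred0.
(* Every allowable path meets the class in as many edges as [S0], so the load on the class does not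
   depend on the strategy. *)
have const z : is_strategy j z ->
    \sum_(S in allowable j) z S * #|S :&: parallel_class e|%:R =
    weight j * #|S0 :&: parallel_class e|%:R.
  move=> [_ _ <-]; rewrite mulr_suml; apply: eq_bigr => S Sj.
  by rewrite (card_parallel_class e noC Sj S0j).
by rewrite !const //; [exact: eqy.1|exact: eqx.1].
Qed.

End GameLemmas.

(** * Two equilibria on a long cycle *)

Section AffineCosts.
Variable R : realType.

Lemma affine_admissible (s q : R) : 0 < s -> 0 <= q ->
  admissible_cost (fun x => s * x + q).
Proof.
move=> s0 q0; split.
- by move=> x x0; rewrite addr_ge0 // mulr_ge0 // ltW.
- by move=> x y _ _ xy; rewrite ltrD2r ltr_pM2l.
- move=> x _; rewrite -[X in derivable X]/(cst s * (@id R) + cst q).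
  by apply: derivableD; [apply: derivableM|].
- have lim : (s @[h --> (0 : R)^'+] --> s)%classic by exact: cvg_cst.
  apply/cvg_ex; exists s; apply: cvg_trans lim; apply: near_eq_cvg; near=> h.
  have h0 : 0 < h by near: h; exact: nbhs_right_gt.
  by field; rewrite gt_eqF.
- move=> t x y _ _; rewrite !convRE /= /unstable.onem.
  rewrite le_eqVlt; apply/orP; left; apply/eqP.
  rewrite /conv /= /GRing.scale /= /unstable.onem; ring.
Unshelve. all: by end_near.
Qed.

Variables (G : multigraph) (Ga : game R G) (x : profile Ga).
Variables s q : player Ga -> edge G -> R.
Hypothesis costE : forall i e (a : R), cost i e a = s i e * a + q i e.
Hypothesis s_ge0 : forall i e, 0 <= s i e.

(** [K] is the marginal cost. A deviation changes the cost by its linear part, non-negative because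
    no path is cheaper than [l i], plus the slopes times the squared changes of load. *)
Lemma affine_equilibrium (l : player Ga -> R) :
  (forall i, is_strategy i (x i)) ->
  let K i e := s i e * (load x e + player_load x i e) + q i e in
  (forall i S, S \in allowable i -> l i <= \sum_(e in S) K i e) ->
  (forall i, \sum_e K i e * player_load x i e = l i * weight i) ->
  is_equilibrium x.
Proof.
move=> sx K le_l eq_l; split=> // i z sz.
have zl : l i * weight i <= \sum_e K i e * path_load i z e.
  rewrite sum_path_load; case: sz => z0 _ <-; rewrite mulr_sumr.
  by apply: ler_sum => S Si; rewrite mulrC ler_wpM2l // le_l.
rewrite -subr_ge0; apply: le_trans (_ : 0 <= \sum_e K i e * path_load i z e -
    \sum_e K i e * player_load x i e) _; first by rewrite eq_l subr_ge0.
rewrite /player_cost -!sumrB; apply: ler_sum => e _.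
rewrite load_deviate player_load_deviate !costE /K.
rewrite -subr_ge0; set a := load x e; set b := player_load x i e.
set d := path_load i z e.
have -> : (s i e * (a + (d - b)) + q i e) * d - (s i e * a + q i e) * b -
   ((s i e * (a + b) + q i e) * d - (s i e * (a + b) + q i e) * b) =
   s i e * (d - b) ^+ 2 by ring.
by rewrite mulr_ge0 ?sqr_ge0.
Qed.

End AffineCosts.

(** * The six-player game on three arcs and its two equilibria *)

Section ThreeArcsGame.
Variables (R : realType) (G : multigraph).
Variables (tau : edge G -> option 'I_3) (src snk : 'I_3 -> vertex G).
Hypothesis arcs : three_arcs tau src snk.

Let D := arc_of tau.
Let D' := co_arc_of tau.

(* Normalizes the costs so that only the arc matters, not its length. *)
Definition arc_weight (l : 'I_3) : R := #|D l|%:R^-1.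

Lemma card_arc_gt0 l : 0 < #|D l|%:R :> R.
Proof.
have [e el] := arc_nonempty arcs l.
by rewrite ltr0n; apply/card_gt0P; exists e; rewrite inE el.
Qed.

Lemma arc_weight_gt0 l : 0 < arc_weight l.
Proof. by rewrite invr_gt0 card_arc_gt0. Qed.

(** Spreads [kappa l] evenly over the edges of arc [l]; [m] is the value off the cycle. *)
Definition arc_sum_fun (kappa : 'I_3 -> R) (m : R) e : R :=
  if tau e is Some l then arc_weight l * kappa l else m.

Lemma sum_arc kappa m l : \sum_(e in D l) arc_sum_fun kappa m e = kappa l.
Proof.
rewrite (eq_bigr (fun=> arc_weight l * kappa l)).
  by rewrite sumr_const -mulr_natr mulrAC mulVf ?mul1r // gt_eqF ?card_arc_gt0.
by move=> e; rewrite inE /arc_sum_fun => /eqP ->.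
Qed.

Lemma sum_co_arc kappa m j :
  \sum_(e in D' j) arc_sum_fun kappa m e = \sum_(l | l != j) kappa l.
Proof.
(* The default [j] is excluded from the index set, so edges off the cycle fall into no block. *)
rewrite (partition_big (fun e => odflt j (tau e)) (fun l => l != j)) /=.
  apply: eq_bigr => l lj; rewrite -[RHS](sum_arc kappa m); apply: eq_bigl => e.
  rewrite !inE; case: (tau e) => [l'|] //=.
    rewrite -[Some l' == Some j]/(l' == j) -[Some l' == Some l]/(l' == l).
    by case: (l' =P l) => [->|]; rewrite ?lj ?andbF.
move=> e; rewrite inE; case: (tau e) => //=.
Qed.

(* The constants make both routes equally expensive at the margin: when everybody
   uses her own arc (load 2 on the cycle), 6 * (2 + 1) = 2 * (2 + 7) = 18; when
   everybody uses the complementary arc (load 4), 6 * 4 = 2 * (4 + 1 + 7) = 24.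
   An edge off the cycle has marginal cost at least 24. *)
Definition arc_slope (i : 'I_3 * bool) e : R :=
  if tau e is Some l then arc_weight l * (if l == i.1 then 6 else 1) else 1.

Definition arc_const (i : 'I_3 * bool) e : R :=
  if tau e is Some l then arc_weight l * (if l == i.1 then 0 else 7) else 24.

Lemma arc_slope_gt0 i e : 0 < arc_slope i e.
Proof.
rewrite /arc_slope; case: (tau e) => [l|//].
by rewrite mulr_gt0 ?arc_weight_gt0 //; case: ifP.
Qed.

Lemma arc_const_ge0 i e : 0 <= arc_const i e.
Proof.
rewrite /arc_const; case: (tau e) => [l|//].
by rewrite mulr_ge0 ?(ltW (arc_weight_gt0 _)) //; case: ifP.
Qed.

Lemma src_snk_connected j : connected_in (src j) (snk j).
Proof.
have /simple_path_setP[p /and3P[wp /eqP lp _] _] := arc_path arcs j.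
by exists p.
Qed.

(** The Boolean only tells the two players of an arc apart. *)
Definition arcs_game : game R G := @Game R G ('I_3 * bool)%type
  (fun=> 1) (fun i => src i.1) (fun i => snk i.1)
  (fun i e a => arc_slope i e * a + arc_const i e)
  (fun=> ler01) (fun i => src_snk_connected i.1)
  (fun i e => affine_admissible (arc_slope_gt0 i e) (arc_const_ge0 i e)).

Definition arcs_choice (b : bool) j : {set edge G} := if b then D' j else D j.

Definition arcs_profile (b : bool) : profile arcs_game :=
  fun i S => (S == arcs_choice b i.1)%:R.

Lemma arcs_choice_allowable b (i : player arcs_game) :
  arcs_choice b i.1 \in allowable i.
Proof. by case: b; [apply: co_arc_path arcs _|apply: arc_path arcs _]. Qed.

Lemma arcs_profile_strategy b i : is_strategy i (arcs_profile b i).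
Proof.
split=> [S|S SN|]; rewrite /arcs_profile.
- exact: ler0n.
- case: eqP => // E; by move: SN; rewrite E arcs_choice_allowable.
- rewrite (bigD1 (arcs_choice b i.1)) ?arcs_choice_allowable //= eqxx.
  by rewrite big1 ?addr0 // => S /andP[_ /negPf ->].
Qed.

Lemma arcs_player_load b i e :
  player_load (arcs_profile b) i e = (e \in arcs_choice b i.1)%:R.
Proof.
rewrite /player_load /arcs_profile.
have [ei|ei] := boolP (e \in arcs_choice b i.1).
  rewrite (bigD1 (arcs_choice b i.1)) ?arcs_choice_allowable ?ei //= eqxx.
  by rewrite big1 ?addr0 // => S /andP[_ /negPf ->].
rewrite big1 // => S /andP[_ eS]; case: eqP => // E.
by move: ei; rewrite -E eS.
Qed.

Lemma in_arcs_choice b j e : (e \in arcs_choice b j) =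
  if tau e is Some l then (l == j) (+) b else false.
Proof.
rewrite /arcs_choice; case: b; rewrite inE; case: (tau e) => //= l.
- by rewrite addbT.
- by rewrite addbF.
Qed.

(** An arc is used either by its own two players or by the four players of the other arcs. *)
Lemma arcs_load b e : load (arcs_profile b) e =
  if tau e is Some _ then (if b then 4 else 2) else 0.
Proof.
rewrite /load; under eq_bigr do rewrite arcs_player_load in_arcs_choice.
case: (tau e) => [l|]; last by rewrite big1.
rewrite -(pair_big xpredT xpredT (fun j (_ : bool) => ((l == j) (+) b)%:R)) /=.
under eq_bigr do rewrite sumr_const card_bool.
rewrite !big_ord_recl big_ord0 -!val_eqE.
by case: b; case: l => [[|[|[|//]]] l3] /=; ring.
Qed.

(** Marginal cost of the whole arc [l] for a player of arc [j]. Her own arc costs twice as much as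
    each of the other two, so both routes cost the same. *)
Definition arcs_kappa (b : bool) (j l : 'I_3) : R :=
  (if b then 12 else 9) * (if l == j then 2 else 1).

Definition arcs_lambda (b : bool) : R := if b then 24 else 18.

Definition arcs_marginal b (i : 'I_3 * bool) e : R :=
  arc_sum_fun (arcs_kappa b i.1) 24 e.

Lemma arcs_marginalE b i e :
  arc_slope i e * (load (arcs_profile b) e + player_load (arcs_profile b) i e)
    + arc_const i e = arcs_marginal b i e.
Proof.
rewrite arcs_load arcs_player_load in_arcs_choice.
rewrite /arcs_marginal /arc_slope /arc_const /arc_sum_fun /arcs_kappa.
by case: (tau e) => [l|] /=; [case: (l == i.1); case: b => /=|]; ring.
Qed.

Lemma sum_arcs_choice_marginal b i :
  \sum_(e in arcs_choice b i.1) arcs_marginal b i e = arcs_lambda b.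
Proof.
case: b; rewrite /arcs_choice /arcs_marginal /arcs_lambda /arcs_kappa.
  rewrite sum_co_arc (eq_bigr (fun=> 12)) => [|l /negPf ->]; last by rewrite mulr1.
  by rewrite sumr_const cardC1 card_ord /=; lra.
by rewrite sum_arc eqxx; lra.
Qed.

Lemma sum_arcs_other_marginal b i :
  \sum_(e in arcs_choice (~~ b) i.1) arcs_marginal b i e = arcs_lambda b.
Proof.
case: b; rewrite /arcs_choice /arcs_marginal /arcs_lambda /arcs_kappa /=.
  by rewrite sum_arc eqxx; lra.
rewrite sum_co_arc (eq_bigr (fun=> 9)) => [|l /negPf ->]; last by rewrite mulr1.
by rewrite sumr_const cardC1 card_ord /=; lra.
Qed.

Lemma arcs_marginal_ge0 b i e : 0 <= arcs_marginal b i e.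
Proof.
rewrite /arcs_marginal /arc_sum_fun; case: (tau e) => [l|//].
rewrite mulr_ge0 ?(ltW (arc_weight_gt0 _)) // mulr_ge0 //; first by case: b.
by case: ifP.
Qed.

(** A path on the cycle contains one of the two routes, both of cost [arcs_lambda b]; any other path
    pays 24 for a single edge off the cycle. *)
Lemma arcs_lambda_le b (i : player arcs_game) S : S \in allowable i ->
  arcs_lambda b <= \sum_(e in S) arcs_marginal b i e.
Proof.
move=> Si.
have le_subset b' : arcs_choice b' i.1 \subset S ->
    arcs_lambda b <= \sum_(e in S) arcs_marginal b i e.
  move=> /finset.setIidPr sub; rewrite (big_setID (arcs_choice b' i.1)) /= sub.
  have -> : \sum_(e in arcs_choice b' i.1) arcs_marginal b i e = arcs_lambda b.
    have [->|] := eqVneq b' b; first exact: sum_arcs_choice_marginal.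
    move=> neq; have -> : b' = ~~ b by case: b' b neq {sub} => [] [].
    exact: sum_arcs_other_marginal.
  by rewrite lerDl; apply: sumr_ge0 => e _; exact: arcs_marginal_ge0.
have [/forall_inP SU|] := boolP [forall (e | e \in S), tau e != None].
  have [sub|sub] := arc_or_co_arc arcs Si SU; first exact: (le_subset false).
  exact: (le_subset true).
rewrite negb_forall_in => /exists_inP[e eS]; rewrite negbK => /eqP te.
rewrite (bigD1 e) //= {1}/arcs_marginal /arc_sum_fun te ler_wpDr //.
  by apply: sumr_ge0 => f _; exact: arcs_marginal_ge0.
by rewrite /arcs_lambda; case: (b); lra.
Qed.

Lemma arcs_profile_equilibrium b : is_equilibrium (arcs_profile b).
Proof.
apply: (@affine_equilibrium R G arcs_game _ arc_slope arc_const _ _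
          (fun=> arcs_lambda b)) => //.
- by move=> i e; rewrite ltW // arc_slope_gt0.
- exact: arcs_profile_strategy.
- by move=> i S Si; under eq_bigr do rewrite arcs_marginalE; exact: arcs_lambda_le.
- move=> i; rewrite mulr1 -[RHS](sum_arcs_choice_marginal b i) [RHS]big_mkcond.
  apply: eq_bigr => e _; rewrite arcs_marginalE arcs_player_load.
  by case: ifP => _; rewrite ?mulr1 ?mulr0.
Qed.

Lemma arcs_game_not_unique : ~ unique_equilibria arcs_game.
Proof.
apply; exists (arcs_profile false), (arcs_profile true).
split; try exact: arcs_profile_equilibrium.
have [e e0] := arc_nonempty arcs ord0; exists (ord0, false), e.
rewrite !arcs_player_load !in_arcs_choice e0 eqxx /= => /eqP.
by rewrite oner_eq0.
Qed.

End ThreeArcsGame.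

Theorem theorem8p2 (R : realType) (G : multigraph) :
  uniqueness_property R G <->
  ~ exists (v : vertex G) (p : seq (edge G * vertex G)),
      is_cycle v p /\ (3 <= size p)%N.
Proof.
split=> [uniq_eq [v [p [cyc size_p]]] | noC Ga].
  have [tau [src [snk arcs]]] := cycle_three_arcs cyc size_p.
  exact: (@arcs_game_not_unique R _ _ _ _ arcs (uniq_eq _)).
exact: equilibria_unique.
Qed.
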